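(* Let $P_t$ evolve by the Fokker--Planck equation $\partial_tP_t=-\nabla\cdot(\boldsymbol\nu_tP_t)$ on $\mathbb R^d$ with mean local velocity $\boldsymbol\nu_t=\mu(\boldsymbol F_t-T\nabla\ln P_t)$, where $P_\tau$ decays sufficiently rapidly at infinity, let $\boldsymbol\nu^*_\tau=\nabla\phi_\tau$ be the optimal mean local velocity, and let $\mathbb P$ be the forward path probability density over the time step from $\tau$ to $\tau+dt$. Then the entropy production rate, the excess entropy production rate and the housekeeping entropy production rate are given by $$\sigma_\tau=\frac2{dt}\,g_{\theta(\boldsymbol0)\theta(\boldsymbol0)}(\mathbb P),\qquad \sigma^{\rm ex}_\tau=\frac2{dt}\,g_{\theta(\boldsymbol\nu_\tau-\boldsymbol\nu^*_\tau)\theta(\boldsymbol\nu_\tau-\boldsymbol\nu^*_\tau)}(\mathbb P),\qquad \sigma^{\rm hk}_\tau=\frac2{dt}\,g_{\theta(\boldsymbol\nu^*_\tau)\theta(\boldsymbol\nu^*_\tau)}(\mathbb P).$$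
   Context: $\mu>0$, $T>0$ are constants and $\boldsymbol F_t:\mathbb R^d\to\mathbb R^d$ is a force field. For a vector field $\boldsymbol\nu'$ on $\mathbb R^d$, $\theta\in[0,1]$ and a time step $dt>0$, $\mathbb P^\theta_{\boldsymbol\nu'}(\boldsymbol x_{\tau+dt},\boldsymbol x_\tau)=\mathbb T^\theta_{\tau;\boldsymbol\nu'}(\boldsymbol x_{\tau+dt}\mid\boldsymbol x_\tau)P_\tau(\boldsymbol x_\tau)$ with $$\mathbb T^\theta_{\tau;\boldsymbol\nu'}(\boldsymbol x_{\tau+dt}\mid\boldsymbol x_\tau)=\frac1{(4\pi\mu T\,dt)^{d/2}}\exp\Big[-\frac{\|\boldsymbol x_{\tau+dt}-\boldsymbol x_\tau-\mu\boldsymbol F_\tau(\boldsymbol x_\tau)dt-\theta[\boldsymbol\nu'(\boldsymbol x_\tau)-\boldsymbol\nu_\tau(\boldsymbol x_\tau)]dt\|^2}{4\mu T\,dt}\Big].$$ The forward path probability density is $\mathbb P=\mathbb P^0_{\boldsymbol\nu'}$ (independent of $\boldsymbol\nu'$). The Fisher information of the interpolation parameter is $$g_{\theta(\boldsymbol\nu')\theta(\boldsymbol\nu')}(\mathbb P)=\lim_{\Delta\theta\to0}\frac{2D_{\rm KL}(\mathbb P\|\mathbb P^{\Delta\theta}_{\boldsymbol\nu'})}{(\Delta\theta)^2},$$ with $D_{\rm KL}$ the Kullback--Leibler divergence. The rates are defined by $\sigma_\tau=\frac1{\mu T}\int d\boldsymbol x\,\|\boldsymbol\nu_\tau\|^2P_\tau$,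 $\sigma^{\rm ex}_\tau=\frac1{\mu T}\lim_{\Delta t\to0}[\mathcal W_2(P_\tau,P_{\tau+\Delta t})]^2/(\Delta t)^2$ with $\mathcal W_2$ the $L^2$-Wasserstein distance, and $\sigma^{\rm hk}_\tau=\sigma_\tau-\sigma^{\rm ex}_\tau$. The optimal mean local velocity is $\boldsymbol\nu^*_\tau=\nabla\phi_\tau$, where $\phi_\tau$ is the potential with $\partial_\tau P_\tau=-\nabla\cdot(P_\tau\nabla\phi_\tau)$; it satisfies $\lim_{\Delta t\to0}[\mathcal W_2(P_\tau,P_{\tau+\Delta t})]^2/(\Delta t)^2=\int d\boldsymbol x\,\|\boldsymbol\nu^*_\tau\|^2P_\tau$. ''Decays sufficiently rapidly at infinity'' means that boundary terms at infinity in integrations by parts against $P_\tau$ vanish. Functions are taken regular enough that all displayed expressions are defined and finite. *)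

(* Defs.v *)
From HB Require Import structures.
From mathcomp Require Import all_boot all_order all_algebra.
From mathcomp Require Import all_classical all_reals all_analysis.

Set Implicit Arguments.
Unset Strict Implicit.
Unset Printing Implicit Defensive.
Import Order.TTheory GRing.Theory Num.Theory.
Import numFieldNormedType.Exports.

Local Open Scope classical_set_scope.
Local Open Scope ring_scope.

(* ['rV[R]_n] carries the sigma-algebra generated by the coordinates, i.e. the
   Borel sets of R^n. *)
Definition measure_rV_display : measure_display.
Proof. exact: default_measure_display. Qed.

Section measurable_rV.
Context {R : realType} {n : nat}.

Let coor : 'I_n -> 'rV[R]_n -> measurableTypeR R := fun i v => v ord0 i.

Let rV_set0 : g_sigma_preimage coor set0.
Proof. exact: sigma_algebra0. Qed.

Let rV_setC A : g_sigma_preimage coor A -> g_sigma_preimage coor (~` A).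
Proof. exact: sigma_algebraC. Qed.

Let rV_bigcup (F : _^nat) : (forall i, g_sigma_preimage coor (F i)) ->
  g_sigma_preimage coor (\bigcup_i (F i)).
Proof. exact: sigma_algebra_bigcup. Qed.

HB.instance Definition _ := @isMeasurable.Build measure_rV_display
  'rV[R]_n (g_sigma_preimage coor) rV_set0 rV_setC rV_bigcup.

Lemma measurable_coor (i : 'I_n) :
  measurable_fun [set: 'rV[R]_n] (fun v : 'rV[R]_n => v ord0 i : measurableTypeR R).
Proof.
move=> _ Y mY; rewrite setTI; apply: sub_sigma_algebra => /=.
rewrite -bigcup_seq/=; exists i => /=; first by rewrite mem_index_enum.
by exists Y => //; rewrite setTI.
Qed.

Lemma measurable_fun_coorP d (T : measurableType d) (f : T -> 'rV[R]_n) :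
  (forall i, measurable_fun [set: T] (fun x => f x ord0 i : measurableTypeR R)) ->
  measurable_fun [set: T] f.
Proof.
move=> mf.
suff: g_sigma_preimage (fun i => coor i \o f) `<=` measurable.
  rewrite g_sigma_preimage_comp => prefS.
  by move=> _ A mA; rewrite setTI; apply: prefS; exists A; rewrite // setTI.
apply: smallest_sub; first exact: sigma_algebra_measurable.
by rewrite -bigcup_seq => A [i /= _ [B mB <-]]; exact: mf.
Qed.

End measurable_rV.

Section lebesgue_rV.
Context {R : realType}.

Definition cons_rV n (p : measurableTypeR R * 'rV[R]_n) : 'rV[R]_n.+1 :=
  \row_i oapp (fun k => p.2 ord0 k) p.1 (unlift ord0 i).

Fixpoint lebesgue_rV n : set 'rV[R]_n -> \bar R :=
  match n with
  | 0 => fun A => \d_(0 : 'rV[R]_0) A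
  | n.+1 => pushforward
      (product_measure2 (@lebesgue_measure R) (@lebesgue_rV n)) (@cons_rV n)
  end.

Lemma measurable_cons_rV n : measurable_fun [set: _] (@cons_rV n).
Proof.
apply: measurable_fun_coorP => i.
under eq_fun do rewrite mxE.
case: (unliftP ord0 i) => [j|] _ /=; last exact: measurable_fst.
exact: (measurableT_comp (measurable_coor j) measurable_snd).
Qed.

Let is_measure n : exists m : {measure set 'rV[R]_n -> \bar R},
  m = @lebesgue_rV n :> (set _ -> _).
Proof.
elim: n => [|n [m mE]]; first by exists (\d_(0 : 'rV[R]_0)).
pose m2 := product_measure2 (@lebesgue_measure R) m.
pose m' := measure_function_pushforward__canonical__measure_function_Measure
  m2 (@measurable_cons_rV n).
by exists m'; rewrite /= -mE.
Qed.


Let lebesgue_rV0 n : @lebesgue_rV n set0 = 0%E.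
Proof. by have [m <-] := is_measure n; exact: measure0. Qed.

Let lebesgue_rV_ge0 n A : (0 <= @lebesgue_rV n A)%E.
Proof. by have [m <-] := is_measure n; exact: measure_ge0. Qed.

Let lebesgue_rV_sigma_additive n : semi_sigma_additive (@lebesgue_rV n).
Proof.
by have [m <-] := is_measure n; exact: measure_semi_sigma_additive.
Qed.

HB.instance Definition _ n := isMeasure.Build _ _ _ (@lebesgue_rV n)
  (lebesgue_rV0 n) (@lebesgue_rV_ge0 n) (@lebesgue_rV_sigma_additive n).

Lemma measurable_rect n (A : 'I_n -> set (measurableTypeR R)) :
  (forall i, measurable (A i)) ->
  measurable [set v : 'rV[R]_n | forall i, A i (v ord0 i)].
Proof.
move=> mA.
rewrite (_ : mkset _ = \big[setI/setT]_(i < n)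
    ((fun v : 'rV[R]_n => v ord0 i : measurableTypeR R) @^-1` A i)); last first.
  rewrite -bigcap_seq; apply/seteqP; split=> [v Av i _|v Av i]; first exact: Av.
  by apply: (Av i); rewrite /= mem_index_enum.
apply: bigsetI_measurable => i _; rewrite -[X in measurable X]setTI.
exact: measurable_coor.
Qed.

Lemma lebesgue_rV_rect n (A : 'I_n -> set (measurableTypeR R)) :
  (forall i, measurable (A i)) ->
  lebesgue_rV [set v : 'rV[R]_n | forall i, A i (v ord0 i)] =
  (\prod_(i < n) lebesgue_measure (A i))%E.
Proof.
elim: n A => [|n IH] A mA.
  by rewrite big_ord0 /= diracE mem_set// => -[].
rewrite big_ord_recl -IH//= /pushforward.
pose B := [set v : 'rV[R]_n | forall i, A (lift ord0 i) (v ord0 i)].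
have mB : measurable B.
  by apply: (measurable_rect (A := fun i => A (lift ord0 i))) => i; exact: mA.
rewrite -[RHS](product_measure2E lebesgue_measure (@lebesgue_rV n) (mA ord0) mB).
congr (product_measure2 _ _ _); apply/seteqP; split=> -[s w] /=.
  move=> Asw; split=> [|i].
    by have := Asw ord0; rewrite mxE unlift_none.
  by have := Asw (lift ord0 i); rewrite mxE liftK.
move=> [As Aw] i; rewrite mxE; by case: (unliftP ord0 i) => [j ->|->].
Qed.

Let lebesgue_rV_sigma_finite n : sigma_finite setT (@lebesgue_rV n).
Proof.
exists (fun k : nat => [set v : 'rV[R]_n |
  forall i, `[- k%:R, k%:R]%classic (v ord0 i)]).
  apply/esym/seteqP; split=> // v _.
  have S0 : 0 <= \sum_i `|v ord0 i| by exact: sumr_ge0.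
  exists (Num.bound (\sum_i `|v ord0 i|)) => // i /=.
  rewrite in_itv/= -ler_norml; apply: (le_trans _ (ltW (archi_boundP S0))).
  by rewrite (bigD1 i)//= lerDl sumr_ge0.
move=> k; split; first exact: (measurable_rect (A := fun=> _)).
rewrite (lebesgue_rV_rect (A := fun=> _))// ltey_eq prode_fin_num// => i _.
by rewrite lebesgue_measure_itv/=; case: ifPn.
Qed.

HB.instance Definition _ n := @Measure_isSigmaFinite.Build _ _ _
  (@lebesgue_rV n) (lebesgue_rV_sigma_finite n).

End lebesgue_rV.

Section vector_calculus.
Context {R : realType} {d : nat}.
Implicit Types (f p : 'rV[R]_d -> R) (v : 'rV[R]_d -> 'rV[R]_d).

(* The library norm on ['rV[R]_d] is the sup norm; this is the Euclidean one. *)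
Definition enorm (u : 'rV[R]_d) : R := Num.sqrt (\sum_i u ord0 i ^+ 2).

Definition grad f (x : 'rV[R]_d) : 'rV[R]_d :=
  \row_i 'D_(delta_mx ord0 i) f x.

Definition divergence v (x : 'rV[R]_d) : R :=
  \sum_i 'D_(delta_mx ord0 i) (fun y => v y ord0 i) x.

Definition continuously_differentiable (W : normedModType R)
    (g : 'rV[R]_d -> W) : Prop :=
  (forall x, differentiable g x) /\ forall u, continuous (fun x => 'D_u g x).

Definition probability_density p : Prop :=
  [/\ measurable_fun [set: 'rV[R]_d] p, forall x, 0 < p x &
      (\int[@lebesgue_rV R d]_x (p x)%:E = 1)%E].

(* The point whose [i]-th coordinate is [s], the others being given by [y]. *)
Definition face_point (i : 'I_d) (s : R) (y : 'rV[R]_d.-1) : 'rV[R]_d :=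
  \row_j oapp (fun k => y ord0 k) s (unlift i j).

Definition cube n (r : R) : set 'rV[R]_n := [set y | forall k, `|y ord0 k| <= r].

(* Outward flux of [v] through the boundary of the cube [-r, r]^d: the faces
   orthogonal to the [i]-th axis are parametrized by [-r, r]^(d-1). *)
Definition cube_flux v (r : R) : \bar R :=
  (\sum_(i < d) \int[@lebesgue_rV R d.-1]_(y in @cube d.-1 r)
     (v (face_point i r y) ord0 i - v (face_point i (- r) y) ord0 i)%:E)%E.

(* The boundary term at infinity vanishes in the integration by parts
   \int f div(p v) = - \int p (grad f . v). *)
Definition boundary_term_vanishes p f v : Prop :=
  cube_flux (fun x => (f x * p x) *: v x) r @[r --> +oo%R] --> 0%E.

End vector_calculus.

(* Relative entropy of densities with respect to [m], with 0 ln (0 / q) = 0 and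
   p ln (p / 0) = +oo for p > 0. *)
Definition kl_divergence (R : realType) (disp : measure_display)
    (X : measurableType disp) (m : set X -> \bar R) (p q : X -> R) : \bar R :=
  (\int[m]_z (if p z == 0%R then 0 else if q z == 0%R then +oo
              else (p z * ln (p z / q z))%:E))%E.

Section wasserstein.
Context {R : realType} {d : nat}.
Implicit Types p q : 'rV[R]_d -> R.

Definition coupling p q
    (g : {measure set ('rV[R]_d * 'rV[R]_d) -> \bar R}) : Prop :=
  (forall A, measurable A ->
     g (A `*` setT) = (\int[@lebesgue_rV R d]_(x in A) (p x)%:E)%E) /\
  (forall B, measurable B ->
     g (setT `*` B) = (\int[@lebesgue_rV R d]_(y in B) (q y)%:E)%E).

Definition wasserstein2 p q : \bar R :=
  poweR (ereal_inf [set (\int[g]_z (enorm (z.1 - z.2) ^+ 2)%:E)%E |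
                    g in coupling p q]) 2^-1.

End wasserstein.

Section fokker_planck.
Context {R : realType} {d : nat}.
Variables (mu T : R) (F : R -> 'rV[R]_d -> 'rV[R]_d) (P : R -> 'rV[R]_d -> R).
Implicit Types (t tau dt theta : R) (v : 'rV[R]_d -> 'rV[R]_d).

Definition mean_local_velocity t (x : 'rV[R]_d) : 'rV[R]_d :=
  mu *: (F t x - T *: grad (fun y => ln (P t y)) x).

(* [continuity_equation t v]: the time derivative of P at t exists and equals
   - div (v P_t). *)
Definition continuity_equation t v : Prop :=
  forall x, is_derive t 1 (fun s => P s x)
              (- divergence (fun y => P t y *: v y) x).

Definition transition_density tau dt v theta (x' x : 'rV[R]_d) : R :=
  ((4 * pi * mu * T * dt) `^ (d%:R / 2))^-1 *
  expR (- (enorm (x' - x - (mu * dt) *: F tau x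
                  - (theta * dt) *: (v x - mean_local_velocity tau x)) ^+ 2
           / (4 * mu * T * dt))).

(* Densities on pairs (x_{tau+dt}, x_tau). *)
Definition path_density tau dt v theta (z : 'rV[R]_d * 'rV[R]_d) : R :=
  transition_density tau dt v theta z.1 z.2 * P tau z.2.

Definition forward_path_density tau dt := path_density tau dt (cst 0) 0.

Lemma forward_path_densityE tau dt v :
  path_density tau dt v 0 = forward_path_density tau dt.
Proof.
by apply/funext => z; rewrite /forward_path_density /path_density
  /transition_density !mul0r !scale0r.
Qed.

Definition fisher_quotient tau dt v theta : \bar R :=
  (2%:E * kl_divergence (product_measure1 (@lebesgue_rV R d) (@lebesgue_rV R d))
            (forward_path_density tau dt) (path_density tau dt v theta)
   * (theta ^- 2)%:E)%E.

Definition fisher_information tau dt v : \bar R :=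
  lim (fisher_quotient tau dt v theta @[theta --> 0^']).

Definition wasserstein_speed2 tau (h : R) : \bar R :=
  (wasserstein2 (P tau) (P (tau + h)) ^+ 2 * (h ^- 2)%:E)%E.

Definition entropy_production_rate tau : \bar R :=
  ((mu * T)^-1%:E *
   \int[@lebesgue_rV R d]_x (enorm (mean_local_velocity tau x) ^+ 2 * P tau x)%:E)%E.

Definition excess_rate tau : \bar R :=
  ((mu * T)^-1%:E * lim (wasserstein_speed2 tau h @[h --> 0%R^']))%E.

Definition housekeeping_rate tau : \bar R :=
  (entropy_production_rate tau - excess_rate tau)%E.

End fokker_planck.

(* Main.v *)
(* Write u = v - nu_tau. Given x_tau = x, the increment of the forward path is
   Gaussian, and ln (P / P^theta_v) is an affine function of the centered
   increment whose constant term is theta^2 dt |u(x)|^2 / (4 mu T); the linear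
   term averages to zero. Hence D_KL (P || P^theta_v) is exactly
   theta^2 dt / (4 mu T) times the P_tau-mean of |u|^2, and the three rates become
   the second moments of nu, grad phi and nu - grad phi.
   That the last of these is the difference of the first two amounts to grad phi
   being orthogonal to w = nu - grad phi in L^2(P_tau). Both nu and grad phi solve the continuity equation, so
   div (P_tau w) = 0 and P_tau (grad phi . w) = div (phi P_tau w); its integral
   over a growing cube is a boundary flux, which vanishes at infinity. *)

Require Import Defs.
From HB Require Import structures.
From mathcomp Require Import all_boot all_order all_algebra.
From mathcomp Require Import all_classical all_reals all_analysis.
From mathcomp Require Import measurable_realfun ring lra.

Set Implicit Arguments.
Unset Strict Implicit.
Unset Printing Implicit Defensive.
Import Order.TTheory GRing.Theory Num.Theory.
Import numFieldNormedType.Exports.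

Local Open Scope classical_set_scope.
Local Open Scope ring_scope.

(** * Borel sets of R^n and uniqueness of Lebesgue measure *)

Section borel_rV.
Context {R : realType}.

(** Coordinate preimages are rectangles whose other sides are full, so rectangles generate. They are
    moreover stable under intersection, as a uniqueness argument for measures requires. *)
Lemma measurable_rV_rectE n :
  @measurable _ 'rV[R]_n =
  <<s [set X | exists2 A : 'I_n -> set (measurableTypeR R),
         forall i, measurable (A i) &
         X = [set v : 'rV[R]_n | forall i, A i (v ord0 i)]] >>.
Proof.
apply/seteqP; split; last first.
  apply: smallest_sub; first exact: sigma_algebra_measurable.
  by move=> _ [A mA ->]; exact: measurable_rect.
apply: smallest_sub; first exact: smallest_sigma_algebra.
rewrite -bigcup_seq => _ [i /= _ [B mB <-]]; apply: sub_sigma_algebra.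
exists (fun j => if j == i then B else setT).
  by move=> j; case: ifP.
apply/seteqP; split => [v [_ Bv] j|v /(_ i)]; first by case: eqP => // ->.
by rewrite eqxx.
Qed.

(** Rectangles form a pi-system, and the cubes [-k, k]^n exhaust the space with finite measure. This
    frees [lebesgue_rV], built by splitting off coordinate 0, from the order of the coordinates. *)
Lemma lebesgue_rV_unique n (m : {measure set 'rV[R]_n -> \bar R}) :
  (forall A : 'I_n -> set (measurableTypeR R), (forall i, measurable (A i)) ->
    m [set v | forall i, A i (v ord0 i)] =
    (\prod_(i < n) lebesgue_measure (A i))%E) ->
  forall X, measurable X -> lebesgue_rV X = m X.
Proof.
move=> mE; apply: (measure_unique _ (fun k : nat => [set v : 'rV[R]_n |
  forall i, `[- k%:R, k%:R]%classic (v ord0 i)]) (measurable_rV_rectE n)).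
- move=> _ _ [A mA ->] [B mB ->]; exists (fun i => A i `&` B i).
    by move=> i; exact: measurableI.
  by apply/seteqP; split=> [v [] Av Bv i|v ABv]; [split|split=> i; have [] := ABv i].
- by move=> k; exists (fun=> `[- k%:R, k%:R]%classic).
- apply/seteqP; split=> // v _.
  have S0 : 0 <= \sum_i `|v ord0 i| by exact: sumr_ge0.
  exists (Num.bound (\sum_i `|v ord0 i|)) => // i /=.
  rewrite in_itv/= -ler_norml; apply: (le_trans _ (ltW (archi_boundP S0))).
  by rewrite (bigD1 i)//= lerDl sumr_ge0.
- by move=> _ [A mA ->]; exact: etrans (lebesgue_rV_rect mA) (esym (mE _ mA)).
- move=> k; suff: (\prod_(i < n) lebesgue_measure ([set` `[- k%:R, k%:R]%R] : set R) < +oo)%E.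
    by rewrite -(lebesgue_rV_rect (A := fun=> _)).
  rewrite ltey_eq prode_fin_num// => i _.
  by rewrite lebesgue_measure_itv/=; case: ifPn.
Qed.

Lemma ball_rV n (x : 'rV[R]_n) e : 0 < e ->
  ball x e = [set v | forall i, ball (x ord0 i) e (v ord0 i)].
Proof.
move=> e0; apply/seteqP; split=> v; first by move=> [_ xv] i; exact: xv.
by move=> xv; split=> // i j; rewrite (ord1 i); exact: xv.
Qed.

(** In the sup norm balls are rectangles, hence measurable, and countably many balls with rational
    centres and radii fill an open set. *)
Lemma open_measurable_rV n (U : set 'rV[R]_n) : open U -> measurable U.
Proof.
move=> oU.
pose q (p : 'rV[rat]_n * nat) : 'rV[R]_n := \row_i ratr (p.1 ord0 i).
(* A ball that leaves [U] is replaced by the empty set, so that the union runs over a whole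
   countable type. *)
pose G p := if `[< ball (q p) (p.2.+1%:R^-1) `<=` U >]
            then ball (q p) (p.2.+1%:R^-1) else set0.
rewrite (_ : U = \bigcup_p G p).
  apply: countable_bigcupT_measurable; first exact: countableP.
  move=> p; rewrite /G; case: asboolP => // _.
  rewrite ball_rV ?invr_gt0//.
  apply: (measurable_rect (A := fun i => ball (q p ord0 i) (p.2.+1%:R^-1))) => i.
  exact: open_measurable (ball_open _ _).
apply/seteqP; split=> [x Ux|x [p _]]; last by rewrite /G; case: asboolP => // + ?; exact.
have /nbhs_ballP[e /= e0 eU] : nbhs x U by exact: open_nbhs_nbhs.
have e20 : 0 < e / 2 by rewrite divr_gt0.
(* Radius below [e / 2]: a ball of this radius whose centre is also within this radius of [x] stays
   inside [ball x e]. *)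
have [k /andP[k0 ke]] : exists k : nat, 0 < (k.+1%:R^-1 : R) < e / 2.
  exists (Num.bound (e / 2)^-1); rewrite invr_gt0 ltr0n/= invf_plt ?posrE//.
  rewrite (lt_trans (archi_boundP _))// ?ltr_nat// ltW// invr_gt0//.
have qx (i : 'I_n) : exists r : rat, ball (x ord0 i) (k.+1%:R^-1) (ratr r : R).
  have [y [xy [r _ ry]]] := dense_rat
    (ex_intro _ (x ord0 i) (ballxx _ k0)) (ball_open _ _).
  by exists r; rewrite ry.
pose r := \row_i sval (cid (qx i)).
have rx : ball (q (r, k)) (k.+1%:R^-1) x.
  rewrite ball_rV// => i; apply: ball_sym; rewrite !mxE/=.
  by case: cid.
exists (r, k) => //; rewrite /G; case: asboolP => //= -[] y qy; apply: eU.
rewrite (splitr e); apply: (@ball_triangle _ _ (q (r, k))).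
  exact: le_ball (ltW ke) _ (ball_sym rx).
exact: le_ball (ltW ke) _ qy.
Qed.

Lemma continuous_measurable_rV n (f : 'rV[R]_n -> R) :
  continuous f -> measurable_fun setT (f : _ -> measurableTypeR R).
Proof.
move=> /continuousP cf; apply: (measurability _ (RGenOpens.measurableE R)).
move=> _ [_ [a [b ->] <-]]; rewrite setTI; apply: open_measurable_rV.
by apply: cf; exact: interval_open.
Qed.

End borel_rV.

(** * Fubini along an arbitrary coordinate axis *)

Section face_point.
Context {R : realType}.

Lemma measurable_face_point n (i : 'I_n.+1) :
  measurable_fun setT (fun p : measurableTypeR R * 'rV[R]_n => face_point i p.1 p.2).
Proof.
apply: measurable_fun_coorP => j; under eq_fun do rewrite mxE.
case: (unliftP i j) => [k|] _ /=; last exact: measurable_fst.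
exact: (measurableT_comp (measurable_coor k) measurable_snd).
Qed.

Let face_measure n (i : 'I_n.+1) :=
  measure_function_pushforward__canonical__measure_function_Measure
    (product_measure1 (@lebesgue_measure R) (@lebesgue_rV R n))
    (measurable_face_point i).

(** On a rectangle, taking the i-th factor out of the product of lengths identifies both sides;
    uniqueness extends this to all measurable sets. *)
Let lebesgue_rV_face n (i : 'I_n.+1) X : measurable X ->
  lebesgue_rV X = pushforward
    (product_measure1 (@lebesgue_measure R) (@lebesgue_rV R n))
    (fun p : measurableTypeR R * 'rV[R]_n => face_point i p.1 p.2) X.
Proof.
apply: (lebesgue_rV_unique (m := face_measure i)) => A mA /=.
rewrite /pushforward (bigD1_ord i)//=.
rewrite -(lebesgue_rV_rect (A := fun k => A (lift i k)))//.
have mB : measurable [set v : 'rV[R]_n | forall k, A (lift i k) (v ord0 k)].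
  by apply: (measurable_rect (A := fun k => A (lift i k))).
rewrite -[RHS](product_measure1E lebesgue_measure (@lebesgue_rV R n) (mA i) mB).
congr (product_measure1 _ _ _); apply/seteqP; split=> -[s w] /=.
  move=> Asw; split=> [|k]; first by have := Asw i; rewrite mxE unlift_none.
  by have := Asw (lift i k); rewrite mxE liftK.
by move=> [As Aw] k; rewrite mxE; case: (unliftP i k) => [j ->|->] //=.
Qed.

Local Open Scope ereal_scope.

Lemma ge0_integral_rV_face_point n (i : 'I_n.+1) (f : 'rV[R]_n.+1 -> \bar R) :
  measurable_fun setT f -> (forall x, 0 <= f x) ->
  \int[@lebesgue_rV R n.+1]_x f x =
  \int[@lebesgue_rV R n]_y \int[lebesgue_measure]_s f (face_point i s y).
Proof.
move=> mf f0.
rewrite (eq_measure_integral (face_measure i)); last first.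
  by move=> A mA _; exact: lebesgue_rV_face.
rewrite ge0_integral_pushforward//; last exact: measurable_face_point.
rewrite preimage_setT fubini_tonelli2//=.
by apply: measurableT_comp => //; exact: measurable_face_point.
Qed.

Lemma integral_rV_face_point n (i : 'I_n.+1) (f : 'rV[R]_n.+1 -> \bar R) :
  (@lebesgue_rV R n.+1).-integrable setT f ->
  \int[@lebesgue_rV R n.+1]_x f x =
  \int[@lebesgue_rV R n]_y \int[lebesgue_measure]_s f (face_point i s y).
Proof.
move=> /integrableP[mf foo].
have mfi : measurable_fun setT
    (f \o (fun p : measurableTypeR R * 'rV[R]_n => face_point i p.1 p.2)).
  by apply: measurableT_comp => //; exact: measurable_face_point.
have intf : (product_measure1 (@lebesgue_measure R) (@lebesgue_rV R n)).-integrable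
    setT (f \o (fun p : measurableTypeR R * 'rV[R]_n => face_point i p.1 p.2)).
  (* Tonelli applied to [abse \o f] supplies the integrability of the pulled-back function. *)
  apply/integrable21ltyP => //.
  have mabs : measurable_fun setT (abse \o f) by exact: measurableT_comp.
  have <- := ge0_integral_rV_face_point i mabs (fun=> abse_ge0 _).
  exact: foo.
rewrite (eq_measure_integral (face_measure i)); last first.
  by move=> A mA _; exact: lebesgue_rV_face.
rewrite integral_pushforward//; last exact: measurable_face_point.
by rewrite preimage_setT -integral21_prod_meas1.
Qed.

End face_point.

(** * First moments of the centred normal law on the line *)

Section normal_first_moment.
Context {R : realType}.
Implicit Types m s : R.
Local Notation mu := (@lebesgue_measure R).

(** The reflection about [m] exchanges the half-lines and leaves [f] invariant; its derivative is
    -1, so the substitution introduces no factor. *)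
Lemma ge0_integral_symmetric_halves m (f : R -> R) : continuous f ->
  (forall x, 0 <= f x) -> (forall x, f (m + m - x) = f x) ->
  (\int[mu]_(x in `]-oo, m]) (f x)%:E = \int[mu]_(x in `[m, +oo[) (f x)%:E)%E.
Proof.
move=> cf f0 fsym; pose F x : R := m + m - x.
have F'E : derive1 F = cst (-1).
  apply/funext => x; rewrite derive1E /F.
  by rewrite (_ : (fun x => _) = cst (m + m) - id)// deriveB// derive_cst derive_id sub0r.
have Fm : F m = m by rewrite /F addrK.
have := @decreasing_ge0_integration_by_substitutiony R F f m.
rewrite Fm => ->.
- apply: eq_integral => x _; congr (EFin _); rewrite /= F'E /= !fctE /= opprK mulr1.
  exact: fsym.
- by move=> x y _ _ xy; rewrite /F ltrD2l ltrN2.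
- by rewrite F'E => x _; exact: cst_continuous.
- by rewrite F'E; exact: is_cvg_cst.
- by rewrite F'E; exact: is_cvg_cst.
- split; first by move=> x _; rewrite /F; exact: derivableB.
  apply: cvg_at_right_filter; apply: cvgB; [exact: cvg_cst|exact: cvg_id].
- apply/cvgrNyPle => A; near=> x; rewrite /F lerBlDl -lerBlDr.
  by near: x; apply: nbhs_pinfty_ge; exact: num_real.
- exact: continuous_subspaceT.
- by move=> x _; exact: f0.
Unshelve. all: by end_near. Qed.

(* From [y <= 1 + y^2 / 4 <= exp (y^2 / 4)] with [y = `|x - m| / s]. *)
Lemma normr_normal_fun_le m s x : 0 < s ->
  `|x - m| * normal_fun m s x <= s * normal_fun m (s * Num.sqrt 2) x.
Proof.
move=> s0; rewrite /normal_fun exprMn sqr_sqrtr//.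
pose y := `|x - m| / s.
have xmE : `|x - m| = s * y by rewrite /y mulrC divfK// gt_eqF.
rewrite -[(x - m) ^+ 2]real_normK ?num_real// xmE.
have -> : - (s * y) ^+ 2 / (s ^+ 2 *+ 2) = - (y ^+ 2 / 4) - y ^+ 2 / 4.
  by field; rewrite gt_eqF.
have -> : - (s * y) ^+ 2 / ((s ^+ 2 * 2) *+ 2) = - (y ^+ 2 / 4).
  by field; rewrite gt_eqF.
rewrite expRD mulrA -mulrA -(mulrA s) ler_pM2l// mulrCA ger_pMr ?expR_gt0//.
rewrite expRN ler_pdivrMr ?expR_gt0// mul1r.
apply: le_trans (expR_ge1Dx _); have := sqr_ge0 (1 - y / 2); rewrite sqrrB; lra.
Qed.

Lemma measurable_normrB m : measurable_fun setT (fun x : R => `|x - m|).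
Proof.
apply: continuous_measurable_fun => x.
by apply: cvg_norm; apply: cvgB; [exact: cvg_id|exact: cvg_cst].
Qed.

(** Trading the linear factor for a standard deviation larger by sqrt 2 leaves a multiple of another
    normal density, of mass 1. The bound does not depend on [m], which later makes it uniform in the
    starting point of a path step. *)
Lemma normal_abs_moment_le m s : 0 < s ->
  (\int[mu]_x (`|x - m| * normal_pdf m s x)%:E <=
   (normal_peak s * s * (normal_peak (s * Num.sqrt 2))^-1)%:E)%E.
Proof.
move=> s0; pose s2 := s * Num.sqrt 2.
have s20 : 0 < s2 by rewrite mulr_gt0 ?sqrtr_gt0.
have mn k s' : measurable_fun setT (fun x => (k * normal_pdf m s' x)%:E).
  by apply/measurable_EFinP/measurable_funM => //; exact: measurable_normal_pdf.
pose k := normal_peak s * s * (normal_peak s2)^-1.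
have k0 : 0 <= k by rewrite !mulr_ge0 ?invr_ge0 ?normal_peak_ge0// ltW.
have : (\int[mu]_x (`|x - m| * normal_pdf m s x)%:E <=
    \int[mu]_x (k * normal_pdf m s2 x)%:E)%E.
  apply: ge0_le_integral => //.
  - by move=> x _; rewrite lee_fin mulr_ge0 ?normal_pdf_ge0.
  - apply/measurable_EFinP/measurable_funM; last exact: measurable_normal_pdf.
    exact: measurable_normrB.
  - exact: mn.
  - move=> x _; rewrite lee_fin !normal_pdfE ?gt_eqF// /k.
    have -> : normal_peak s * s * (normal_peak s2)^-1 *
        (normal_peak s2 * normal_fun m s2 x) = normal_peak s * (s * normal_fun m s2 x).
      by rewrite -!mulrA mulKf// gt_eqF// normal_peak_gt0// gt_eqF.
    by rewrite mulrCA ler_wpM2l ?normal_peak_ge0 ?normr_normal_fun_le.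
move/le_trans; apply; under eq_integral do rewrite EFinM.
rewrite ge0_integralZl_EFin//.
- by rewrite integral_normal_pdf mule1.
- by move=> x _; rewrite lee_fin normal_pdf_ge0.
- by apply/measurable_EFinP; exact: measurable_normal_pdf.
Qed.

(** Each integrand is [|x - m|] times the density, cut off to one side of [m], and the reflection
    about [m] exchanges the sides. *)
Lemma normal_moment_halves m s : 0 < s ->
  (\int[mu]_x (Num.max (x - m) 0 * normal_pdf m s x)%:E =
   \int[mu]_x (Num.max (m - x) 0 * normal_pdf m s x)%:E)%E.
Proof.
move=> s0; pose f x := `|x - m| * normal_pdf m s x.
transitivity (\int[mu]_(x in `[m, +oo[) (f x)%:E)%E.
  rewrite [RHS]integral_mkcond; apply: eq_integral => x _.
  rewrite patchE mem_setE in_itv/= andbT /f; case: ifPn => [mx|].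
    by rewrite max_l ?subr_ge0// ger0_norm ?subr_ge0.
  by rewrite -ltNge => xm; rewrite max_r ?mul0r// subr_le0 ltW.
transitivity (\int[mu]_(x in `]-oo, m]) (f x)%:E)%E; last first.
  rewrite integral_mkcond; apply: eq_integral => x _.
  rewrite patchE mem_setE in_itv/= /f; case: ifPn => [mx|].
    by rewrite max_l ?subr_ge0// ler0_norm ?subr_le0// opprB.
  by rewrite -ltNge => xm; rewrite max_r ?mul0r// subr_le0 ltW.
apply/esym/ge0_integral_symmetric_halves.
- move=> x; apply: cvgM; last by apply: continuous_normal_pdf; rewrite gt_eqF.
  by apply: cvg_norm; apply: cvgB; [exact: cvg_id|exact: cvg_cst].
- by move=> x; rewrite mulr_ge0 ?normal_pdf_ge0.
- move=> x; rewrite /f !normal_pdfE ?gt_eqF// /normal_fun.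
  by rewrite (_ : m + m - x - m = - (x - m)) ?normrN ?sqrrN//; ring.
Qed.

End normal_first_moment.

(** * Isotropic Gaussian densities on R^n *)

Section gauss.
Context {R : realType}.

(** Tonelli splits off coordinate 0 in an induction on the dimension; in dimension 0 the measure is
    a unit point mass and both sides are empty products. *)
Lemma ge0_integral_rV_prod n (f : 'I_n -> R -> R) :
  (forall i, measurable_fun setT (f i)) -> (forall i x, 0 <= f i x) ->
  (\int[@lebesgue_rV R n]_x (\prod_i f i (x ord0 i))%:E =
   \prod_i \int[@lebesgue_measure R]_t (f i t)%:E)%E.
Proof.
elim: n f => [|n IH] f mf f0.
  rewrite /= integral_dirac//; last first.
    by under eq_fun do rewrite big_ord0; exact: measurable_cst.
  by rewrite diracT mul1e !big_ord0.
have mprod k (g : 'I_k -> R -> R) : (forall i, measurable_fun setT (g i)) ->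
    measurable_fun setT (fun x : 'rV[R]_k => \prod_i g i (x ord0 i)).
  move=> mg; apply: measurable_prod => i _.
  exact: measurableT_comp (mg i) (measurable_coor i).
rewrite (ge0_integral_rV_face_point ord0); last 2 first.
- by apply/measurable_EFinP; exact: mprod.
- by move=> x; rewrite lee_fin prodr_ge0.
transitivity (\int[@lebesgue_rV R n]_y
    ((\int[@lebesgue_measure R]_t (f ord0 t)%:E) *
     (\prod_i f (lift ord0 i) (y ord0 i))%:E))%E.
  apply: eq_integral => y _; rewrite muleC -ge0_integralZl_EFin ?prodr_ge0//.
  - apply: eq_integral => t _; rewrite -EFinM mulrC; congr (EFin _).
    rewrite big_ord_recl mxE unlift_none/=; congr (_ * _).
    by apply: eq_bigr => i _; rewrite mxE liftK.
  - by move=> t _; rewrite lee_fin.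
  - by apply/measurable_EFinP; exact: mf.
rewrite ge0_integralZl//.
- by rewrite big_ord_recl; congr (_ * _)%E; exact: (IH (fun i => f (lift ord0 i))).
- by apply/measurable_EFinP; exact: (mprod _ (fun i => f (lift ord0 i))).
- by move=> x _; rewrite lee_fin prodr_ge0.
- by apply: integral_ge0 => t _; rewrite lee_fin.
Qed.

(** The Gaussian density with mean [m] and covariance s^2 times the identity, written as a product
    over coordinates so that integrals factor. *)
Definition gauss n (s : R) (m x : 'rV[R]_n) : R :=
  \prod_i normal_pdf (m ord0 i) s (x ord0 i).

Lemma gauss_ge0 n s (m x : 'rV[R]_n) : 0 <= gauss s m x.
Proof. by apply: prodr_ge0 => i _; exact: normal_pdf_ge0. Qed.

Lemma measurable_gauss n s (m : 'rV[R]_n) : measurable_fun setT (gauss s m).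
Proof.
apply: measurable_prod => i _.
exact: measurableT_comp (measurable_normal_pdf _ _) (measurable_coor i).
Qed.

Lemma integral_gauss n s (m : 'rV[R]_n) :
  (\int[@lebesgue_rV R n]_x (gauss s m x)%:E = 1)%E.
Proof.
rewrite (@ge0_integral_rV_prod n (fun i => normal_pdf (m ord0 i) s)).
- by rewrite big1// => i _; exact: integral_normal_pdf.
- by move=> i; exact: measurable_normal_pdf.
- by move=> i x; exact: normal_pdf_ge0.
Qed.

(** Marginalization: every coordinate other than [i] integrates to 1. *)
Lemma ge0_integral_gauss_coord n s (m : 'rV[R]_n) i (h : R -> R) :
  measurable_fun setT h -> (forall t, 0 <= h t) ->
  (\int[@lebesgue_rV R n]_x (h (x ord0 i) * gauss s m x)%:E =
   \int[@lebesgue_measure R]_t (h t * normal_pdf (m ord0 i) s t)%:E)%E.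
Proof.
move=> mh h0.
pose f j t := (if j == i then h t else 1) * normal_pdf (m ord0 j) s t.
have f0 j t : 0 <= f j t by rewrite mulr_ge0 ?normal_pdf_ge0//; case: ifP.
transitivity (\int[@lebesgue_rV R n]_x (\prod_j f j (x ord0 j))%:E)%E.
  apply: eq_integral => x _; congr (EFin _).
  rewrite big_split/= -/(gauss s m x) -big_mkcond/= (big_pred1 i)//.
rewrite ge0_integral_rV_prod//; last first.
  move=> j; apply: measurable_funM; last exact: measurable_normal_pdf.
  by case: (j == i).
rewrite (bigD1 i)//= [X in (_ * X)%E]big1 ?mule1.
  by apply: eq_integral => t _; rewrite /f eqxx.
move=> j /negPf ji; rewrite -[RHS](integral_normal_pdf (m ord0 j) s).
by apply: eq_integral => t _; rewrite /f ji mul1r.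
Qed.

Lemma abs_moment_gauss_le n s (m : 'rV[R]_n) i : 0 < s ->
  (\int[@lebesgue_rV R n]_x (`|x ord0 i - m ord0 i| * gauss s m x)%:E <=
   (normal_peak s * s * (normal_peak (s * Num.sqrt 2))^-1)%:E)%E.
Proof.
move=> s0.
rewrite (ge0_integral_gauss_coord s m i (h := fun t => `|t - m ord0 i|))//.
  exact: normal_abs_moment_le.
exact: measurable_normrB.
Qed.

Lemma integral_gauss_centered n s (m : 'rV[R]_n) i : 0 < s ->
  (\int[@lebesgue_rV R n]_x ((x ord0 i - m ord0 i) * gauss s m x)%:E = 0)%E.
Proof.
move=> s0; rewrite integralE.
rewrite [X in (X - _)%E](_ : _ =
    \int[@lebesgue_rV R n]_x (Num.max (x ord0 i - m ord0 i) 0 * gauss s m x)%:E)%E;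
  last first.
  apply: eq_integral => x _; rewrite funeposE -EFin_max maxr_pMl ?gauss_ge0//.
  by rewrite mul0r.
rewrite [X in (_ - X)%E](_ : _ =
    \int[@lebesgue_rV R n]_x (Num.max (m ord0 i - x ord0 i) 0 * gauss s m x)%:E)%E;
  last first.
  apply: eq_integral => x _; rewrite funenegE -EFinN -EFin_max maxr_pMl ?gauss_ge0//.
  by rewrite mul0r -mulNr opprB.
have mp : measurable_fun setT (fun t : R => Num.max (t - m ord0 i) 0).
  by apply: measurable_maxr => //; exact: measurable_funB.
have mm : measurable_fun setT (fun t : R => Num.max (m ord0 i - t) 0).
  by apply: measurable_maxr => //; exact: measurable_funB.
have ge0 (g : R -> R) t : 0 <= Num.max (g t) 0 by rewrite le_max lexx orbT.
rewrite (ge0_integral_gauss_coord s m i mp (ge0 _)).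
rewrite (ge0_integral_gauss_coord s m i mm (ge0 _)).
(* The one-sided moments agree, but their difference is 0 only when they are finite; the absolute
   moment bounds them. *)
rewrite -normal_moment_halves// subee// ge0_fin_numE; last first.
  by apply: integral_ge0 => t _; rewrite lee_fin mulr_ge0 ?normal_pdf_ge0.
apply: le_lt_trans (ltry _); apply: le_trans (normal_abs_moment_le (m ord0 i) s0).
apply: ge0_le_integral => //.
- by move=> t _; rewrite lee_fin mulr_ge0 ?normal_pdf_ge0.
- by apply/measurable_EFinP/measurable_funM => //; exact: measurable_normal_pdf.
- apply/measurable_EFinP/measurable_funM; last exact: measurable_normal_pdf.
  exact: measurable_normrB.
- move=> t _; rewrite lee_fin ler_wpM2r ?normal_pdf_ge0//.
  by rewrite ge_max ler_norm normr_ge0.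
Qed.

End gauss.

(** * Exhaustion of R^n by cubes *)

Section cubes.
Context {R : realType}.

Lemma cube_rectE n (r : R) :
  @cube R n r = [set y | forall k, `[- r, r]%classic (y ord0 k)].
Proof.
by apply/seteqP; split=> y yr k; have := yr k; rewrite /= in_itv/= ler_norml.
Qed.

Lemma measurable_cube n (r : R) : measurable (@cube R n r).
Proof.
by rewrite cube_rectE; apply: (measurable_rect (A := fun=> `[- r, r]%classic)).
Qed.

Lemma lebesgue_rV_cube_lty n (r : R) : (lebesgue_rV (@cube R n r) < +oo)%E.
Proof.
rewrite cube_rectE (lebesgue_rV_rect (A := fun=> `[- r, r]%classic))//.
rewrite ltey_eq prode_fin_num// => i _.
by rewrite lebesgue_measure_itv/=; case: ifPn.
Qed.

Lemma compact_cube n (r : R) : compact (@cube R n r).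
Proof.
rewrite cube_rectE; apply: (rV_compact (A := fun=> `[- r, r]%classic)) => _.
exact: segment_compact.
Qed.

Lemma integrable_cube n (r : R) (f : 'rV[R]_n -> R) : continuous f ->
  (@lebesgue_rV R n).-integrable (@cube R n r) (EFin \o f).
Proof.
move=> cf; apply: measurable_bounded_integrable.
- exact: measurable_cube.
- exact: lebesgue_rV_cube_lty.
- by apply: measurable_funTS; exact: continuous_measurable_rV.
- have /compact_bounded : compact (f @` @cube R n r).
    apply: continuous_compact (@compact_cube n r).
    exact: continuous_subspaceT.
  move=> [M [Mr fM]]; exists M; split=> // y My x rx.
  by apply: fM => //; exists x.
Qed.

(** Dominated convergence with bound |f|: a fixed point belongs to all cubes from some index on. *)
Lemma cvg_integral_cube n (f : 'rV[R]_n -> R) :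
  (@lebesgue_rV R n).-integrable setT (EFin \o f) ->
  (\int[@lebesgue_rV R n]_(x in @cube R n k%:R) (f x)%:E @[k --> \oo] -->
   \int[@lebesgue_rV R n]_x (f x)%:E)%E.
Proof.
move=> fi; have mf := measurable_int _ fi.
pose g (k : nat) := (EFin \o f) \_ (@cube R n k%:R).
have mg k : measurable_fun setT (g k).
  have [+ _] := measurable_restrictT (EFin \o f) (@measurable_cube n k%:R).
  by apply; exact: measurable_funTS.
rewrite (_ : (fun k => _) = (fun k => \int[@lebesgue_rV R n]_x g k x)%E); last first.
  by apply/funext => k; rewrite integral_mkcond.
apply: (@dominated_cvg _ _ _ (@lebesgue_rV R n) _ measurableT g (EFin \o f)
  (abse \o (EFin \o f)) mg) => //.
- move=> x _; have nearE : \forall k \near \oo,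
      g k x = (f x)%:E.
    (* The sum of the absolute coordinates bounds each of them, so an integer above it serves as
       this index. *)
    exists (Num.bound (\sum_i `|x ord0 i|)) => // k /= xk.
    rewrite /g patchE mem_set// => i.
    have S0 : 0 <= \sum_i `|x ord0 i| by exact: sumr_ge0.
    apply: (@le_trans _ _ (\sum_i `|x ord0 i|)).
      by rewrite (bigD1 i)//= lerDl sumr_ge0.
    by rewrite (le_trans (ltW (archi_boundP S0)))// ler_nat.
  exact: cvg_near_cst nearE.
- exact: integrable_abse.
- move=> k x _ /=; rewrite /g patchE; case: ifP => // _.
  by rewrite abse0.
Qed.

End cubes.

(** * The divergence theorem on a cube *)

Section divergence_theorem.
Context {R : realType}.

(** Exhibits the point as affine in [s] with direction [delta_mx ord0 i], which is why
    differentiating in [s] gives the i-th partial derivative. *)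
Lemma face_pointE n (i : 'I_n.+1) (s : R) (y : 'rV[R]_n) :
  face_point i s y = s *: delta_mx ord0 i + face_point i 0 y.
Proof.
apply/rowP => j; rewrite !mxE eqxx/=; case: (unliftP i j) => [k ->|->]/=.
  by rewrite eq_sym (negPf (neq_lift _ _)) mulr0 add0r.
by rewrite eqxx mulr1 addr0.
Qed.

Lemma continuous_face_point n (i : 'I_n.+1) (y : 'rV[R]_n) :
  continuous (fun s : R => face_point i s y : 'rV[R]_n.+1).
Proof.
move=> s; under eq_fun do rewrite face_pointE.
rewrite face_pointE; apply: cvgD; last exact: cvg_cst.
by apply: cvgZr_tmp; exact: cvg_id.
Qed.

Lemma cube_face_point n (i : 'I_n.+1) (r s : R) (y : 'rV[R]_n) :
  @cube R n.+1 r (face_point i s y) <-> `[- r, r]%classic s /\ @cube R n r y.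
Proof.
rewrite /= in_itv/= -ler_norml; split=> [sy|[sr yr] j].
  split=> [|k]; first by have := sy i; rewrite mxE unlift_none.
  by have := sy (lift i k); rewrite mxE liftK.
by rewrite mxE; case: (unliftP i j) => [k _|_] /=.
Qed.

(** Fundamental theorem of calculus along a segment parallel to the i-th axis. *)
Lemma integral_partial_segment n (i : 'I_n.+1) (f : 'rV[R]_n.+1 -> R) (r : R)
    (y : 'rV[R]_n) : 0 < r ->
  (forall x, derivable f x (delta_mx ord0 i)) ->
  continuous f ->
  continuous (fun x => 'D_(delta_mx ord0 i) f x) ->
  (\int[@lebesgue_measure R]_(s in [set` `[- r, r]%R])
     ('D_(delta_mx ord0 i) f (face_point i s y))%:E =
   (f (face_point i r y) - f (face_point i (- r) y))%:E)%E.
Proof.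
move=> r0 df cf cdf; pose F s := f (face_point i s y).
(* The difference quotients of [F] and of [f] in direction [i] coincide as functions of [h], so
   derivability and the value of the derivative both carry over. *)
have shiftE s : (fun h : R => h^-1 *: ((F \o shift s) (h *: 1) - F s)) =
    (fun h => h^-1 *: ((f \o shift (face_point i s y)) (h *: delta_mx ord0 i)
                       - f (face_point i s y))).
  apply/funext => h; rewrite /F /=; congr (_ *: (f _ - _)).
  by rewrite face_pointE (face_pointE i s) addrA -scalerDl /= [h *: 1]mulr1.
have dF s : derivable F s 1 by rewrite /derivable shiftE; exact: df.
have cF : continuous F.
  by move=> s; apply: continuous_comp; [exact: continuous_face_point|exact: cf].
rewrite (@continuous_FTC2 _ (fun s => 'D_(delta_mx ord0 i) f (face_point i s y)) F)//.
- by rewrite gtrN.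
- apply: continuous_subspaceT => s.
  apply: (@continuous_comp _ _ _ (fun s => face_point i s y)
    (fun x => 'D_(delta_mx ord0 i) f x)); [exact: continuous_face_point|exact: cdf].
- split=> [s _||]; first exact: dF.
  + exact: cvg_at_right_filter (cF _).
  + exact: cvg_at_left_filter (cF _).
- by move=> s _; rewrite derive1E /derive shiftE.
Qed.

Lemma integral_partial_cube n (i : 'I_n.+1) (f : 'rV[R]_n.+1 -> R) (r : R) : 0 < r ->
  (forall x, derivable f x (delta_mx ord0 i)) ->
  continuous f ->
  continuous (fun x => 'D_(delta_mx ord0 i) f x) ->
  (\int[@lebesgue_rV R n.+1]_(x in @cube R n.+1 r) ('D_(delta_mx ord0 i) f x)%:E =
   \int[@lebesgue_rV R n]_(y in @cube R n r)
     (f (face_point i r y) - f (face_point i (- r) y))%:E)%E.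
Proof.
move=> r0 df cf cdf; rewrite integral_mkcond.
rewrite (integral_rV_face_point i); last first.
  apply/(integrable_mkcond _ (@measurable_cube R n.+1 r)).1.
  exact: integrable_cube.
rewrite [RHS]integral_mkcond; apply: eq_integral => y _; rewrite patchE.
case: ifPn => [/set_mem yr|/negP yr].
  rewrite -integral_partial_segment// [RHS]integral_mkcond.
  apply: eq_integral => s _; rewrite !patchE.
  congr (if _ then _ else _); apply/idP/idP => /set_mem h; apply/mem_set.
    by have /cube_face_point[] := h.
  by apply/cube_face_point.
(* For [y] outside the smaller cube the whole line misses the cube. *)
rewrite integral0_eq// => s _; rewrite patchE; case: ifPn => // /set_mem.
by move=> /cube_face_point[_ /mem_set].
Qed.

Lemma divergence_theorem_cube n (v : 'rV[R]_n -> 'rV[R]_n) (r : R) : 0 < r ->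
  (forall i x, derivable (fun y => v y ord0 i) x (delta_mx ord0 i)) ->
  (forall i, continuous (fun x => v x ord0 i)) ->
  (forall i, continuous (fun x => 'D_(delta_mx ord0 i) (fun y => v y ord0 i) x)) ->
  (\int[@lebesgue_rV R n]_(x in @cube R n r) (divergence v x)%:E = cube_flux v r)%E.
Proof.
move=> r0 dv cv cdv; rewrite /divergence /cube_flux.
under eq_integral do rewrite -sumEFin.
rewrite integral_sum; last 2 first.
- exact: measurable_cube.
- by move=> i; exact: integrable_cube.
(* Faces have dimension [n.-1], so slicing requires [n] to be a successor; in dimension 0 both sums
   are empty. *)
case: n v dv cv cdv => [|n] v dv cv cdv; first by rewrite !big_ord0.
by apply: eq_bigr => i _; exact: integral_partial_cube.
Qed.

End divergence_theorem.

(** * Orthogonality of gradients and divergence-free fields *)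

Section orthogonality.
Context {R : realType} {n : nat}.
Implicit Types (f p : 'rV[R]_n -> R) (v w : 'rV[R]_n -> 'rV[R]_n).
Local Notation e i := (delta_mx ord0 i).

Lemma C1_continuous (W : normedModType R) (g : 'rV[R]_n -> W) :
  continuously_differentiable g -> continuous g.
Proof. by move=> [dg _] x; exact: differentiable_continuous. Qed.

Lemma C1_derivable (W : normedModType R) (g : 'rV[R]_n -> W) x u :
  continuously_differentiable g -> derivable g x u.
Proof. by move=> [dg _]; exact: diff_derivable. Qed.

Lemma C1_coord_derivable v i x u : continuously_differentiable v ->
  derivable (fun y => v y ord0 i) x u.
Proof. by move=> /(@C1_derivable _ _ x u) /derivable_mxP. Qed.

Lemma C1_coord_continuous v i : continuously_differentiable v ->
  continuous (fun y => v y ord0 i).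
Proof.
move=> /C1_continuous cv x.
apply: (@continuous_comp _ _ _ v (fun y : 'rV[R]_n => y ord0 i)); first exact: cv.
exact: coord_continuous.
Qed.

Lemma C1_coord_continuous_derive v i u : continuously_differentiable v ->
  continuous (fun x => 'D_u (fun y => v y ord0 i) x).
Proof.
move=> C1v x; have -> : (fun x => 'D_u (fun y => v y ord0 i) x) =
    (fun y : 'rV[R]_n => y ord0 i) \o (fun x => 'D_u v x).
  by apply/funext => y; rewrite /= (derive_mx (C1_derivable C1v)) mxE.
apply: continuous_comp; first exact: C1v.2.
exact: coord_continuous.
Qed.

Lemma divergenceM f v x : (forall u, derivable f x u) ->
  (forall i, derivable (fun y => v y ord0 i) x (e i)) ->
  divergence (fun y => f y *: v y) x =
  f x * divergence v x + \sum_i grad f x ord0 i * v x ord0 i.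
Proof.
move=> df dv; rewrite /divergence mulr_sumr -big_split/=; apply: eq_bigr => i _.
rewrite (_ : (fun y => _) = f * (fun y => v y ord0 i)); last first.
  by apply/funext => y; rewrite mxE.
rewrite deriveM//.
by rewrite mxE /= [X in _ + X]mulrC.
Qed.

Lemma divergenceB v w x :
  (forall i, derivable (fun y => v y ord0 i) x (e i)) ->
  (forall i, derivable (fun y => w y ord0 i) x (e i)) ->
  divergence (fun y => v y - w y) x = divergence v x - divergence w x.
Proof.
move=> dv dw; rewrite /divergence -sumrB; apply: eq_bigr => i _.
rewrite (_ : (fun y => _) = (fun y => v y ord0 i) - (fun y => w y ord0 i)); last first.
  by apply/funext => y; rewrite !mxE.
by rewrite deriveB.
Qed.

Lemma C1B (W : normedModType R) (g h : 'rV[R]_n -> W) :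
  continuously_differentiable g -> continuously_differentiable h ->
  continuously_differentiable (fun x => g x - h x).
Proof.
move=> C1g C1h; split=> [x|u x].
  by apply: differentiableB; [exact: C1g.1|exact: C1h.1].
have -> : (fun x => 'D_u (fun x => g x - h x) x) = 'D_u g - 'D_u h.
  by apply/funext => y; rewrite (deriveB (C1_derivable C1g) (C1_derivable C1h)).
exact (continuousB (C1g.2 u x) (C1h.2 u x)).
Qed.

Lemma continuous_deriveM f p u :
  (forall x, derivable f x u) -> (forall x, derivable p x u) ->
  continuous f -> continuous p ->
  continuous (fun x => 'D_u f x) -> continuous (fun x => 'D_u p x) ->
  continuous (fun x => 'D_u (f * p) x).
Proof.
move=> df dp cf cp cdf cdp x.
have -> : (fun x => 'D_u (f * p) x) = f * 'D_u p + p * 'D_u f.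
  by apply/funext => y; rewrite deriveM.
have h := continuousD (continuousM (cf x) (cdp x)) (continuousM (cp x) (cdf x)).
exact h.
Qed.

Lemma C1M f p : continuously_differentiable f -> continuously_differentiable p ->
  continuously_differentiable (f * p).
Proof.
move=> C1f C1p; split=> [x|u x].
  by apply: differentiableM; [exact: C1f.1|exact: C1p.1].
apply: continuous_deriveM.
- by move=> y; exact: C1_derivable.
- by move=> y; exact: C1_derivable.
- exact: C1_continuous.
- exact: C1_continuous.
- exact: C1f.2.
- exact: C1p.2.
Qed.

(** The integrals over cubes of integer half-side converge to the full integral, by integrability,
    and also to 0, being boundary fluxes of the field f p w; limits are unique. *)
Lemma integral_grad_divergence_free p f w :
  continuously_differentiable p -> continuously_differentiable f ->
  continuously_differentiable w ->
  (forall x, divergence (fun y => p y *: w y) x = 0) ->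
  (@lebesgue_rV R n).-integrable setT
    (fun x => (p x * \sum_i grad f x ord0 i * w x ord0 i)%:E) ->
  boundary_term_vanishes p f w ->
  (\int[@lebesgue_rV R n]_x (p x * \sum_i grad f x ord0 i * w x ord0 i)%:E = 0)%E.
Proof.
move=> C1p C1f C1w div0 ig flux0.
have C1fp := C1M C1f C1p.
pose v x := (f x * p x) *: w x.
have vE i : (fun y => v y ord0 i) = (f * p) * (fun y => w y ord0 i).
  by apply/funext => y; rewrite /v mxE.
have dv i x u : derivable (fun y => v y ord0 i) x u.
  by rewrite vE; apply: derivableM; [exact: C1_derivable|exact: C1_coord_derivable].
have divv x : divergence v x = p x * \sum_i grad f x ord0 i * w x ord0 i.
  (* Grouping the field as f times (p w) lets the product rule meet the vanishing divergence of p w,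
     so that only the gradient of [f] remains. *)
  rewrite (_ : v = fun y => f y *: (p y *: w y)); last first.
    by apply/funext => y; rewrite scalerA.
  rewrite divergenceM ?div0 ?mulr0 ?add0r.
  - by rewrite mulr_sumr; apply: eq_bigr => i _; rewrite !mxE mulrCA.
  - by move=> u; exact: C1_derivable.
  - move=> i; rewrite (_ : (fun y => _) = p * (fun y => w y ord0 i)); last first.
      by apply/funext => y; rewrite mxE.
    by apply: derivableM; [exact: C1_derivable|exact: C1_coord_derivable].
have intk := cvg_integral_cube ig.
have flux0k : (cube_flux v k%:R @[k --> \oo] --> 0)%E.
  exact: cvg_comp (@cvgr_idn R) flux0.
rewrite -(cvg_lim _ intk)//; apply: cvg_lim => //.
(* The divergence theorem needs a positive half-side, so the two sequences are compared only for
   large [k]. *)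
apply: cvg_trans flux0k; apply: near_eq_cvg; near=> k.
rewrite -divergence_theorem_cube.
- by apply: eq_integral => x _; rewrite divv.
- by rewrite ltr0n; near: k; exact: nbhs_infty_gt.
- by move=> i x.
- move=> i x; rewrite vE.
  have h := continuousM (C1_continuous C1fp (x := x)) (C1_coord_continuous (i := i) C1w (x := x)).
  exact h.
- move=> i; rewrite vE; apply: continuous_deriveM.
  + by move=> y; exact: C1_derivable.
  + by move=> y; exact: C1_coord_derivable.
  + exact: C1_continuous.
  + exact: C1_coord_continuous.
  + exact: C1fp.2.
  + exact: C1_coord_continuous_derive.
Unshelve. all: by end_near. Qed.

End orthogonality.

(** * Integrals against kernels, and against Gaussian kernels in particular *)

Section gaussian_kernel.
Context {R : realType}.

Section kernel.
Context d1 d2 (T1 : measurableType d1) (T2 : measurableType d2).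
Variables (m1 : {sigma_finite_measure set T1 -> \bar R})
  (m2 : {sigma_finite_measure set T2 -> \bar R}).
Variables (k : T1 * T2 -> R) (g : T2 -> R) (K c : R).
Hypotheses (mk : measurable_fun setT k) (ig : m2.-integrable setT (EFin \o g)).
Hypothesis K_ge0 : 0 <= K.
Hypothesis abs_k : forall y, (\int[m1]_x `|k (x, y)|%:E <= K%:E)%E.
Hypothesis int_k : forall y, (\int[m1]_x (k (x, y))%:E = c%:E)%E.
Local Open Scope ereal_scope.

Let mg : measurable_fun setT g.
Proof. by apply/measurable_EFinP; exact: measurable_int ig. Qed.

Let mkg : measurable_fun setT (fun z => (k z * g z.2)%:E).
Proof.
apply/measurable_EFinP; apply: measurable_funM => //.
exact: measurableT_comp.
Qed.

Let mky y : measurable_fun setT (fun x => (k (x, y))%:E).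
Proof.
by apply/measurable_EFinP; apply: measurableT_comp => //; exact: measurable_pair2.
Qed.

(** Integrating the kernel first leaves at most [K] times |g|; since [K] is uniform in [y], Tonelli
    concludes. *)
Lemma integrable_kernel :
  (product_measure1 m1 m2).-integrable setT (fun z => (k z * g z.2)%:E).
Proof.
apply/integrable21ltyP => //.
have absE y : \int[m1]_x `|(k (x, y) * g y)%:E| =
    `|g y|%:E * \int[m1]_x `|k (x, y)|%:E.
  rewrite -ge0_integralZl_EFin//.
  - by apply: eq_integral => x _; rewrite /= normrM mulrC EFinM.
  - exact: (measurableT_comp (@abse_measurable R setT) (mky y)).
apply: (@le_lt_trans _ _ (\int[m2]_y (K%:E * `|g y|%:E))).
  apply: ge0_le_integral => //.
  - by move=> y _; exact: integral_ge0.
  - have mabs := measurableT_comp (@abse_measurable R setT) mkg.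
    have h := measurable_fun_fubini_tonelli_G (m1 := m1) _ mabs (fun=> abse_ge0 _).
    exact h.
  - apply: emeasurable_funM => //.
    exact: (measurableT_comp (@abse_measurable R setT) (measurable_int _ ig)).
  - by move=> y _; rewrite /= absE muleC lee_wpmul2r.
rewrite ge0_integralZl_EFin//.
  by apply: lte_mul_pinfty => //; have /integrableP[] := ig.
exact: (measurableT_comp (@abse_measurable R setT) (measurable_int _ ig)).
Qed.

(** Fubini with the kernel variable inside: the conditional integral is the constant [c], which
    factors out. *)
Lemma integral_kernel :
  \int[product_measure1 m1 m2]_z (k z * g z.2)%:E = c%:E * \int[m2]_y (g y)%:E.
Proof.
rewrite -integral21_prod_meas1; last exact: integrable_kernel.
rewrite -integralZl//; apply: eq_integral => y _; rewrite /fubini_G/=.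
under eq_integral do rewrite mulrC EFinM.
rewrite integralZl//; first by rewrite int_k muleC.
apply/integrableP; split; first exact: mky.
exact: le_lt_trans (abs_k y) (ltry _).
Qed.

End kernel.

(** Moves the mean into the argument, so that joint measurability in mean and point becomes that of
    a difference. *)
Lemma normal_pdf_center (m s x : R) : s != 0 -> normal_pdf m s x = normal_pdf 0 s (x - m).
Proof. by move=> s0; rewrite !normal_pdfE// /normal_fun subr0. Qed.

Section gauss_kernel.
Context d (T : measurableType d) (n : nat) (mu : {sigma_finite_measure set T -> \bar R}).
Variables (s : R) (m : T -> 'rV[R]_n).
Hypotheses (s_gt0 : 0 < s) (mm : measurable_fun setT m).
Local Notation leb := (@lebesgue_rV R n).

Let mcoord i : measurable_fun setT (fun z : 'rV[R]_n * T => z.1 ord0 i - m z.2 ord0 i).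
Proof.
apply: measurable_funB.
  exact: (measurableT_comp (measurable_coor i) measurable_fst).
exact: (measurableT_comp (measurable_coor i) (measurableT_comp mm measurable_snd)).
Qed.

Lemma measurable_gauss_kernel :
  measurable_fun setT (fun z : 'rV[R]_n * T => gauss s (m z.2) z.1).
Proof.
apply: measurable_prod => i _; under eq_fun do rewrite normal_pdf_center ?gt_eqF//.
exact: measurableT_comp (measurable_normal_pdf _ _) (mcoord i).
Qed.

(** Each term is a kernel times a function of the second variable: [gauss] has conditional mass 1
    and carries [al], while the centred coordinates have conditional mean 0 and remove every
    [be i]. *)
Lemma integral_gauss_kernel_affine (al : T -> R) (be : 'I_n -> T -> R) :
  mu.-integrable setT (EFin \o al) ->
  (forall i, mu.-integrable setT (EFin \o be i)) ->
  (\int[product_measure1 leb mu]_z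
     (gauss s (m z.2) z.1 *
      (al z.2 + \sum_i be i z.2 * (z.1 ord0 i - m z.2 ord0 i)))%:E =
   \int[mu]_y (al y)%:E)%E.
Proof.
move=> ial ibe.
pose k i (z : 'rV[R]_n * T) := (z.1 ord0 i - m z.2 ord0 i) * gauss s (m z.2) z.1.
have mk i : measurable_fun setT (k i).
  by apply: measurable_funM => //; exact: measurable_gauss_kernel.
pose K := normal_peak s * s * (normal_peak (s * Num.sqrt 2))^-1.
have absk i y : (\int[leb]_x `|k i (x, y)|%:E <= K%:E)%E.
  under eq_integral do rewrite /k normrM/= (ger0_norm (gauss_ge0 _ _ _)).
  exact: abs_moment_gauss_le.
have intk i y : (\int[leb]_x (k i (x, y))%:E = 0%:E)%E.
  exact: (integral_gauss_centered (m y) i s_gt0).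
have absg y : (\int[leb]_x `|gauss s (m y) x|%:E <= 1%:E)%E.
  under eq_integral do rewrite (ger0_norm (gauss_ge0 _ _ _)).
  by rewrite integral_gauss.
have intg y : (\int[leb]_x (gauss s (m y) x)%:E = 1%:E)%E by exact: integral_gauss.
transitivity (\int[product_measure1 leb mu]_z
   ((gauss s (m z.2) z.1 * al z.2)%:E + \sum_i (k i z * be i z.2)%:E))%E.
  apply: eq_integral => z _; rewrite sumEFin -EFinD mulrDr; congr (_ + _)%:E.
  by rewrite mulr_sumr; apply: eq_bigr => i _; rewrite /k; ring.
have K_ge0 : 0 <= K by rewrite !mulr_ge0 ?invr_ge0 ?normal_peak_ge0// ltW.
have i1 := integrable_kernel (m1 := leb) measurable_gauss_kernel ial ler01 absg.
have i2 i := integrable_kernel (m1 := leb) (mk i) (ibe i) K_ge0 (absk i).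
rewrite integralD//; last by apply: integrable_sum => // i _.
rewrite integral_sum// (integral_kernel measurable_gauss_kernel ial ler01 absg intg) mul1e.
rewrite big1 ?adde0// => i _.
by rewrite (integral_kernel (mk i) (ibe i) K_ge0 (absk i) (intk i)) mul0e.
Qed.

End gauss_kernel.

End gaussian_kernel.

(** * Kullback-Leibler divergence and Fisher information of a path step *)

Section fokker_planck_divergence.
Context {R : realType} {n : nat}.
Local Notation leb := (@lebesgue_rV R n).

Lemma enorm_sqr (x : 'rV[R]_n) : enorm x ^+ 2 = \sum_i x ord0 i ^+ 2.
Proof. by rewrite sqr_sqrtr// sumr_ge0// => i _; rewrite sqr_ge0. Qed.

Lemma coord_sqr_le_enorm (x : 'rV[R]_n) i : x ord0 i ^+ 2 <= enorm x ^+ 2.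
Proof.
by rewrite enorm_sqr (bigD1 i)//= lerDl sumr_ge0// => j _; rewrite sqr_ge0.
Qed.

Lemma measurable_enorm_sqr d (X : measurableType d) (u : X -> 'rV[R]_n) :
  measurable_fun setT u -> measurable_fun setT (fun x => enorm (u x) ^+ 2).
Proof.
move=> mu; under eq_fun do rewrite enorm_sqr.
apply: measurable_sum => i; apply: measurable_funX.
exact: measurableT_comp (measurable_coor i) mu.
Qed.

Lemma C1_measurable (u : 'rV[R]_n -> 'rV[R]_n) :
  continuously_differentiable u -> measurable_fun setT u.
Proof.
move=> C1u; apply: measurable_fun_coorP => i.
by apply: continuous_measurable_rV; exact: C1_coord_continuous.
Qed.

Variables (mu T : R) (F : R -> 'rV[R]_n -> 'rV[R]_n) (P : R -> 'rV[R]_n -> R).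
Hypotheses (mu_gt0 : 0 < mu) (T_gt0 : 0 < T).
Local Notation nu := (mean_local_velocity mu T F P).

Lemma grad_ln (p : 'rV[R]_n -> R) x i : continuously_differentiable p ->
  (forall y, 0 < p y) ->
  grad (fun y => ln (p y)) x ord0 i = (p x)^-1 * 'D_(delta_mx ord0 i) p x.
Proof.
move=> C1p p0; rewrite mxE.
have dp : differentiable p x by exact: C1p.1.
have dln : differentiable (@ln R) (p x).
  by apply/derivable1_diffP; apply: ex_derive; exact: is_derive1_ln.
rewrite (_ : (fun y => ln (p y)) = @ln R \o p)// deriveE; last exact: (differentiable_comp dp dln).
rewrite (diff_comp dp dln) /= diff1E// -deriveE// derive1E.
by rewrite (@derive_val _ _ _ _ _ _ _ (is_derive1_ln (p0 x))) mulrC.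
Qed.

(** The definition of the mean local velocity, solved for the force, writes [F] as nu / mu + T grad
    ln P, which is continuous under the given regularity. *)
Lemma measurable_force tau : continuously_differentiable (P tau) ->
  (forall x, 0 < P tau x) -> continuously_differentiable (nu tau) ->
  measurable_fun setT (F tau).
Proof.
move=> C1P P0 C1nu.
have FE i : (fun x => F tau x ord0 i) = (fun x => mu^-1 * nu tau x ord0 i +
    T * ((P tau x)^-1 * 'D_(delta_mx ord0 i) (P tau) x)).
  apply/funext => x; rewrite -grad_ln// !mxE mulKf ?gt_eqF//.
  by rewrite subrK.
apply: measurable_fun_coorP => i; rewrite FE; apply: continuous_measurable_rV => x.
have Px0 : P tau x != 0 by rewrite gt_eqF.
have h1 := continuousM (@cst_continuous _ _ mu^-1 x)
  (C1_coord_continuous (i := i) C1nu (x := x)).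
have h2 := continuousM (continuousV Px0 (C1_continuous C1P (x := x)))
  (C1P.2 (delta_mx ord0 i) x).
have h := continuousD h1 (continuousM (@cst_continuous _ _ T x) h2).
exact h.
Qed.

Variables (tau dt : R).
Hypothesis dt_gt0 : 0 < dt.
Local Notation D := (4 * mu * T * dt).

Let D_gt0 : 0 < D. Proof. by rewrite !mulr_gt0. Qed.

Lemma transition_density_gt0 v theta x' x :
  0 < transition_density mu T F P tau dt v theta x' x.
Proof.
by rewrite mulr_gt0 ?expR_gt0// invr_gt0 powR_gt0// !mulr_gt0// pi_gt0.
Qed.

(** The denominator 4 mu T dt is twice the variance 2 mu T dt of each coordinate; the perturbation
    by [theta] only shifts the mean. *)
Lemma transition_density_gauss v theta x' x :
  transition_density mu T F P tau dt v theta x' x =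
  gauss (Num.sqrt (2 * mu * T * dt))
    (x + (mu * dt) *: F tau x + (theta * dt) *: (v x - nu tau x)) x'.
Proof.
have s20 : 0 < 2 * mu * T * dt by rewrite !mulr_gt0.
rewrite /transition_density enorm_sqr mulr_suml -sumrN expR_sum.
rewrite /gauss; under [RHS]eq_bigr do
  rewrite normal_pdfE ?gt_eqF ?sqrtr_gt0// /normal_peak /normal_fun sqr_sqrtr ?ltW//.
rewrite big_split/= prodr_const card_ord; congr (_ * _).
  rewrite exprVn; congr (_^-1).
  have -> : 4 * pi * mu * T * dt = 2 * mu * T * dt * pi *+ 2 by ring.
  have a0 : 0 <= 2 * mu * T * dt * pi *+ 2.
    by rewrite mulrn_wge0// mulr_ge0 ?pi_ge0// ltW.
  (* The n-th power of a square root is the power n / 2 of the normalizing constant. *)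
  by rewrite -powR12_sqrt// -powR_mulrn ?powR_ge0// -powRrM (mulrC 2^-1).
apply: eq_bigr => i _; congr expR; rewrite mulNr !mxE; congr (- (_ / _)); last by ring.
by congr (_ ^+ 2); ring.
Qed.

(** Both path densities share the covariance and the initial law, so the quadratic terms cancel in
    the logarithm of their ratio and the formula is exact at every [theta]. *)
Lemma kl_divergence_path (v : 'rV[R]_n -> 'rV[R]_n) (theta : R) :
  probability_density (P tau) ->
  measurable_fun setT (F tau) -> measurable_fun setT (nu tau) ->
  measurable_fun setT v ->
  (\int[leb]_x (enorm (v x - nu tau x) ^+ 2 * P tau x)%:E < +oo)%E ->
  (kl_divergence (product_measure1 leb leb) (forward_path_density mu T F P tau dt)
     (path_density mu T F P tau dt v theta) =
   (theta ^+ 2 * (dt / (4 * mu * T)))%:E *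
   \int[leb]_x (enorm (v x - nu tau x) ^+ 2 * P tau x)%:E)%E.
Proof.
move=> [mP P0 P1] mF mnu mv fin.
pose u x := v x - nu tau x.
pose m x := x + (mu * dt) *: F tau x.
have mcoo (w : 'rV[R]_n -> 'rV[R]_n) i : measurable_fun setT w ->
    measurable_fun setT (fun x => w x ord0 i).
  by move=> mw; exact: measurableT_comp (measurable_coor i) mw.
have mu_ : measurable_fun setT u.
  apply: measurable_fun_coorP => i.
  rewrite (_ : (fun x => _) = fun x => v x ord0 i - nu tau x ord0 i); last first.
    by apply/funext => x; rewrite /u mxE [X in _ + X]mxE.
  by apply: measurable_funB; [exact: (mcoo _ _ mv)|exact: (mcoo _ _ mnu)].
have mm : measurable_fun setT m.
  apply: measurable_fun_coorP => i; under eq_fun do rewrite !mxE.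
  apply: measurable_funD; first exact: measurable_coor.
  by apply: measurable_funM => //; exact: (mcoo _ _ mF).
have iP : leb.-integrable setT (EFin \o P tau).
  apply/integrableP; split; first by apply/measurable_EFinP.
  under eq_integral do rewrite /= ger0_norm ?ltW//.
  by rewrite P1 ltry.
have iu2 : leb.-integrable setT (fun x => (enorm (u x) ^+ 2 * P tau x)%:E).
  apply/integrableP; split.
    by apply/measurable_EFinP; apply: measurable_funM => //; exact: measurable_enorm_sqr.
  rewrite (eq_integral (fun x => (enorm (u x) ^+ 2 * P tau x)%:E)) => [|x _].
    exact: fin.
  by rewrite /= ger0_norm// mulr_ge0 ?sqr_ge0// ltW.
(* The linear term is dominated through |u_i| <= 1 + |u|^2. *)
have iui i : leb.-integrable setT (fun x => (u x ord0 i * P tau x)%:E).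
  apply: (le_integrable measurableT _ _ (integrableD measurableT iP iu2)).
    by apply/measurable_EFinP; apply: measurable_funM => //; exact: (mcoo _ _ mu_).
  move=> x _; rewrite /= lee_fin normrM (ger0_norm (ltW (P0 x))).
  rewrite -[X in _ <= `|X + _|]mul1r -mulrDl normrM (ger0_norm (ltW (P0 x))).
  rewrite ler_wpM2r ?(ltW (P0 x))//; apply: le_trans (ler_norm _).
  have := coord_sqr_le_enorm (u x) i; have := sqr_ge0 (`|u x ord0 i| - 1).
  rewrite sqrrB expr1n mulr1 real_normK ?num_real//; nra.
(* With y the centred increment, (|y - theta dt u|^2 - |y|^2) / D expands into the constant a |u|^2
   and the linear coefficients -2 theta dt u_i / D; [al] and [be] are these weighted by [P tau]. *)
pose a := theta ^+ 2 * (dt / (4 * mu * T)).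
pose al x := a * (enorm (u x) ^+ 2 * P tau x).
pose be i x := - (2 * theta * dt / D) * (u x ord0 i * P tau x).
have ial : leb.-integrable setT (EFin \o al).
  by rewrite /comp /al; under eq_fun do rewrite EFinM; exact: integrableZl.
have ibe i : leb.-integrable setT (EFin \o be i).
  by rewrite /comp /be; under eq_fun do rewrite EFinM; exact: integrableZl.
have s0 : 0 < Num.sqrt (2 * mu * T * dt) by rewrite sqrtr_gt0 !mulr_gt0.
rewrite -integralZl// -[RHS](integral_gauss_kernel_affine s0 mm ial ibe).
apply: eq_integral => -[x' x] _ /=.
(* Positivity of both densities rules out the exceptional branches of [kl_divergence]. *)
have p0 : 0 < forward_path_density mu T F P tau dt (x', x).
  by rewrite mulr_gt0 ?transition_density_gt0/=.
have q0 : 0 < path_density mu T F P tau dt v theta (x', x).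
  by rewrite mulr_gt0 ?transition_density_gt0/=.
rewrite !gt_eqF//; congr (EFin _).
have gE : gauss (Num.sqrt (2 * mu * T * dt)) (m x) x' =
    transition_density mu T F P tau dt (cst 0) 0 x' x.
  by rewrite transition_density_gauss mul0r scale0r addr0.
rewrite gE /forward_path_density /path_density /= -mulrA; congr (_ * _).
have -> : al x + \sum_i be i x * (x' ord0 i - m x ord0 i) = P tau x *
   (a * enorm (u x) ^+ 2 + \sum_i (- (2 * theta * dt / D) * u x ord0 i) * (x' ord0 i - m x ord0 i)).
  rewrite mulrDr mulr_sumr; congr (_ + _); first by rewrite /al; ring.
  by apply: eq_bigr => i _; rewrite /be; ring.
congr (_ * _).
(* The common factor [P tau x] and then the common normalization cancel, leaving a difference of
   exponents. *)
rewrite -mulf_div divff ?gt_eqF// mulr1 /transition_density -mulf_div divff ?mul1r; last first.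
  by rewrite gt_eqF// invr_gt0 powR_gt0// !mulr_gt0// pi_gt0.
rewrite -expRN -expRD expRK -mulNr opprK -mulrDl !enorm_sqr -sumrN -big_split/=.
rewrite mulr_suml mulr_sumr -big_split/=; apply: eq_bigr => i _.
rewrite !mxE /a; field.
by rewrite !gt_eqF.
Qed.

(** Since the divergence is exactly quadratic in [theta], the quotient is constant away from 0. *)
Lemma cvg_fisher_quotient (v : 'rV[R]_n -> 'rV[R]_n) :
  probability_density (P tau) ->
  measurable_fun setT (F tau) -> measurable_fun setT (nu tau) ->
  measurable_fun setT v ->
  (\int[leb]_x (enorm (v x - nu tau x) ^+ 2 * P tau x)%:E < +oo)%E ->
  (fisher_quotient mu T F P tau dt v theta @[theta --> 0%R^'] -->
   (dt / (2 * mu * T))%:E * \int[leb]_x (enorm (v x - nu tau x) ^+ 2 * P tau x)%:E)%E.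
Proof.
move=> dP mF mnu mv fin; set I := (\int[leb]_x _)%E.
have I_fin : I \is a fin_num.
  rewrite ge0_fin_numE//; apply: integral_ge0 => x _.
  by rewrite lee_fin mulr_ge0 ?sqr_ge0//; have [_ /(_ x) /ltW] := dP.
have quotE theta : theta != 0 -> ((dt / (2 * mu * T))%:E * I =
    fisher_quotient mu T F P tau dt v theta)%E.
  move=> theta0; rewrite /fisher_quotient kl_divergence_path// -/I.
  rewrite -(fineK I_fin) -!EFinM; congr (EFin _); field.
  by rewrite theta0 !gt_eqF.
have near0 : \forall theta \near 0^', ((dt / (2 * mu * T))%:E * I =
    fisher_quotient mu T F P tau dt v theta)%E.
  by near=> theta; apply: quotE; near: theta; exact: nbhs_dnbhs_neq.
apply: cvg_trans (near_eq_cvg near0) _.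
exact: cvg_cst.
Unshelve. all: by end_near. Qed.

Lemma fisher_informationE (v : 'rV[R]_n -> 'rV[R]_n) :
  probability_density (P tau) ->
  measurable_fun setT (F tau) -> measurable_fun setT (nu tau) ->
  measurable_fun setT v ->
  (\int[leb]_x (enorm (v x - nu tau x) ^+ 2 * P tau x)%:E < +oo)%E ->
  ((2 / dt)%:E * fisher_information mu T F P tau dt v =
   (mu * T)^-1%:E * \int[leb]_x (enorm (v x - nu tau x) ^+ 2 * P tau x)%:E)%E.
Proof.
move=> dP mF mnu mv fin; rewrite /fisher_information.
rewrite (cvg_lim _ (cvg_fisher_quotient dP mF mnu mv fin))// muleA -EFinM.
by congr (_%:E * _)%E; field; rewrite !gt_eqF.
Qed.

End fokker_planck_divergence.

(** * Pythagoras for square-integrable fields under a weight *)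

Section orthogonal_decomposition.
Context {R : realType} {n : nat}.
Local Notation leb := (@lebesgue_rV R n).
Implicit Types (u w : 'rV[R]_n -> 'rV[R]_n) (p : 'rV[R]_n -> R).

Lemma enormN (x : 'rV[R]_n) : enorm (- x) = enorm x.
Proof. by congr Num.sqrt; apply: eq_bigr => i _; rewrite mxE sqrrN. Qed.

Lemma enormB_sqr (x y : 'rV[R]_n) :
  enorm (x - y) ^+ 2 =
  enorm x ^+ 2 + enorm y ^+ 2 - 2 * \sum_i x ord0 i * y ord0 i.
Proof.
rewrite !enorm_sqr mulr_sumr -sumrN -!big_split/=; apply: eq_bigr => i _.
by rewrite !mxE; ring.
Qed.

Lemma enormB_sqr_le (x y : 'rV[R]_n) :
  enorm (x - y) ^+ 2 <= 2 * (enorm x ^+ 2 + enorm y ^+ 2).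
Proof.
rewrite !enorm_sqr -big_split mulr_sumr/=; apply: ler_sum => i _.
by rewrite !mxE; have := sqr_ge0 (x ord0 i + y ord0 i); rewrite sqrrD sqrrB; lra.
Qed.

Lemma integrable_enorm_sqr u p : measurable_fun setT u -> measurable_fun setT p ->
  (forall x, 0 <= p x) ->
  (\int[leb]_x (enorm (u x) ^+ 2 * p x)%:E < +oo)%E ->
  leb.-integrable setT (fun x => (enorm (u x) ^+ 2 * p x)%:E).
Proof.
move=> mu mp p0 fin; apply/integrableP; split.
  by apply/measurable_EFinP; apply: measurable_funM => //; exact: measurable_enorm_sqr.
rewrite (eq_integral (fun x => (enorm (u x) ^+ 2 * p x)%:E)) => [//|x _].
by rewrite /= ger0_norm// mulr_ge0 ?sqr_ge0.
Qed.

Lemma integral_enormB_sqr_lty u w p :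
  measurable_fun setT u -> measurable_fun setT w -> measurable_fun setT p ->
  (forall x, 0 <= p x) ->
  (\int[leb]_x (enorm (u x) ^+ 2 * p x)%:E < +oo)%E ->
  (\int[leb]_x (enorm (w x) ^+ 2 * p x)%:E < +oo)%E ->
  (\int[leb]_x (enorm (u x - w x) ^+ 2 * p x)%:E < +oo)%E.
Proof.
move=> mu mw mp p0 finu finw.
have iu := integrable_enorm_sqr mu mp p0 finu.
have iw := integrable_enorm_sqr mw mp p0 finw.
have := integrableZl measurableT 2 (integrableD measurableT iu iw).
move=> /integrable_lty => /(_ measurableT); apply: le_lt_trans.
have muw : measurable_fun setT (fun x => u x - w x).
  apply: measurable_fun_coorP => i; under eq_fun do rewrite mxE [X in _ + X]mxE.
  by apply: measurable_funB; exact: measurableT_comp (measurable_coor i) _.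
apply: ge0_le_integral => //.
- by move=> x _; rewrite lee_fin mulr_ge0 ?sqr_ge0.
- by apply/measurable_EFinP; apply: measurable_funM => //; exact: measurable_enorm_sqr.
- exact: measurable_int (integrableZl measurableT 2 (integrableD measurableT iu iw)).
- move=> x _; rewrite -EFinD -EFinM lee_fin -mulrDl mulrA ler_wpM2r//.
  exact: enormB_sqr_le.
Qed.

(** Pointwise |u|^2 - |g|^2 = |g - u|^2 + 2 g.(u - g), and the cross term integrates to 0. That
    vanishing is assumed conditionally on integrability of the cross term, because the integrability
    is derived here from the three squares. *)
Lemma integral_enormB_sqr_orthogonal u g p :
  measurable_fun setT u -> measurable_fun setT g -> measurable_fun setT p ->
  (forall x, 0 <= p x) ->
  (\int[leb]_x (enorm (u x) ^+ 2 * p x)%:E < +oo)%E ->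
  (\int[leb]_x (enorm (g x) ^+ 2 * p x)%:E < +oo)%E ->
  (leb.-integrable setT (fun x => (p x * \sum_i g x ord0 i * (u x - g x) ord0 i)%:E) ->
   \int[leb]_x (p x * \sum_i g x ord0 i * (u x - g x) ord0 i)%:E = 0)%E ->
  (\int[leb]_x (enorm (u x) ^+ 2 * p x)%:E - \int[leb]_x (enorm (g x) ^+ 2 * p x)%:E =
   \int[leb]_x (enorm (g x - u x) ^+ 2 * p x)%:E)%E.
Proof.
move=> mu mg mp p0 finu fing orth.
have iu := integrable_enorm_sqr mu mp p0 finu.
have ig := integrable_enorm_sqr mg mp p0 fing.
have mgu : measurable_fun setT (fun x => g x - u x).
  apply: measurable_fun_coorP => i; under eq_fun do rewrite mxE [X in _ + X]mxE.
  by apply: measurable_funB; exact: measurableT_comp (measurable_coor i) _.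
have iw := integrable_enorm_sqr mgu mp p0 (integral_enormB_sqr_lty mg mu mp p0 fing finu).
pose c x := p x * \sum_i g x ord0 i * (u x - g x) ord0 i.
have decomp x : enorm (u x) ^+ 2 * p x - enorm (g x) ^+ 2 * p x =
    enorm (g x - u x) ^+ 2 * p x + 2 * c x.
  have -> : u x = g x - (g x - u x) by rewrite opprB addrC subrK.
  rewrite [enorm (g x - (g x - u x)) ^+ 2]enormB_sqr /c opprB addrCA subrr addr0.
  have -> : \sum_i g x ord0 i * (u x - g x) ord0 i =
      - \sum_i g x ord0 i * (g x - u x) ord0 i.
    by rewrite -sumrN; apply: eq_bigr => i _; rewrite !mxE; ring.
  by ring.
have iug := integrableB measurableT iu ig.
have iuw := integrableB measurableT iug iw.
have ic : leb.-integrable setT (EFin \o c).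
  have -> : EFin \o c = (fun x => (2^-1)%R%:E * ((enorm (u x) ^+ 2 * p x)%:E -
      (enorm (g x) ^+ 2 * p x)%:E - (enorm (g x - u x) ^+ 2 * p x)%:E))%E.
    by apply/funext => x /=; rewrite -!EFinB -EFinM decomp; congr EFin; field.
  exact: (integrableZl measurableT 2^-1 iuw).
rewrite -integralB//.
have -> : (\int[leb]_x (enorm (g x - u x) ^+ 2 * p x)%:E =
  \int[leb]_x (enorm (g x - u x) ^+ 2 * p x)%:E + 2%:E * \int[leb]_x (c x)%:E)%E.
  by rewrite orth// mule0 adde0.
rewrite -integralZl// -integralD//; last exact: integrableZl.
by apply: eq_integral => x _; rewrite -EFinB decomp EFinD EFinM.
Qed.

End orthogonal_decomposition.

(** * Identification of the three rates with Fisher informations *)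

Theorem proposition22 (R : realType) (d : nat) (mu T : R)
    (F : R -> 'rV[R]_d -> 'rV[R]_d) (P : R -> 'rV[R]_d -> R)
    (a b tau dt : R) (phi : 'rV[R]_d -> R)
    (d_gt0 : (0 < d)%N) (mu_gt0 : 0 < mu) (T_gt0 : 0 < T) (dt_gt0 : 0 < dt)
    (tau_ab : a < tau < b)
    (densityP : forall t, a < t < b -> probability_density (P t))
    (fokker_planckP : forall t, a < t < b ->
       continuity_equation P t (mean_local_velocity mu T F P t))
    (potential_phi : continuity_equation P tau (grad phi))
    (wasserstein_phi : wasserstein_speed2 P tau h @[h --> 0^'] -->
       (\int[@lebesgue_rV R d]_x (enorm (grad phi x) ^+ 2 * P tau x)%:E)%E)
    (C1_P : continuously_differentiable (P tau))
    (C1_nu : continuously_differentiable (mean_local_velocity mu T F P tau))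
    (C1_phi : continuously_differentiable phi)
    (C1_grad_phi : continuously_differentiable (grad phi))
    (finite_nu : (\int[@lebesgue_rV R d]_x
       (enorm (mean_local_velocity mu T F P tau x) ^+ 2 * P tau x)%:E < +oo)%E)
    (finite_grad_phi : (\int[@lebesgue_rV R d]_x
       (enorm (grad phi x) ^+ 2 * P tau x)%:E < +oo)%E)
    (decayP : boundary_term_vanishes (P tau) phi
       (fun x => mean_local_velocity mu T F P tau x - grad phi x)) :
  [/\ cvg (fisher_quotient mu T F P tau dt (cst (0 : 'rV[R]_d)) theta @[theta --> 0^']),
      cvg (fisher_quotient mu T F P tau dt
             (fun x => mean_local_velocity mu T F P tau x - grad phi x) theta
             @[theta --> 0^']) &
      cvg (fisher_quotient mu T F P tau dt (grad phi) theta @[theta --> 0^'])] /\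
  [/\ entropy_production_rate mu T F P tau =
        ((2 / dt)%:E * fisher_information mu T F P tau dt (cst (0%R : 'rV[R]_d)))%E,
      excess_rate mu T P tau =
        ((2 / dt)%:E * fisher_information mu T F P tau dt
           (fun x => mean_local_velocity mu T F P tau x - grad phi x)%R)%E &
      housekeeping_rate mu T F P tau =
        ((2 / dt)%:E * fisher_information mu T F P tau dt (grad phi))%E].
Proof.
have dP := densityP _ tau_ab; have [mP P0 P1] := dP.
have P_ge0 x : 0 <= P tau x by exact: ltW.
have mnu := C1_measurable C1_nu.
have mgrad := C1_measurable C1_grad_phi.
have mF := measurable_force mu_gt0 C1_P P0 C1_nu.
pose nu := mean_local_velocity mu T F P tau.
have C1_w := C1B C1_nu C1_grad_phi.
have mw := C1_measurable C1_w.
(* The deviations v - nu of the three fields are -nu, -grad phi and grad phi - nu, so the first two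
   second moments are those of nu and grad phi. *)
have u0E x : enorm (cst 0 x - nu x) = enorm (nu x) by rewrite sub0r enormN.
have uexE x : enorm (nu x - grad phi x - nu x) = enorm (grad phi x).
  by rewrite addrC addrA addNr sub0r enormN.
have fin0 : (\int[@lebesgue_rV R d]_x (enorm (cst 0 x - nu x) ^+ 2 * P tau x)%:E < +oo)%E.
  by under eq_integral do rewrite u0E.
have finex : (\int[@lebesgue_rV R d]_x
    (enorm (nu x - grad phi x - nu x) ^+ 2 * P tau x)%:E < +oo)%E.
  by under eq_integral do rewrite uexE.
have finhk : (\int[@lebesgue_rV R d]_x
    (enorm (grad phi x - nu x) ^+ 2 * P tau x)%:E < +oo)%E.
  exact: integral_enormB_sqr_lty.
have m0 : measurable_fun setT (cst (0 : 'rV[R]_d) : 'rV[R]_d -> 'rV[R]_d).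
  exact: measurable_cst.
have sigma_ex : excess_rate mu T P tau = ((mu * T)^-1%:E *
    \int[@lebesgue_rV R d]_x (enorm (grad phi x) ^+ 2 * P tau x)%:E)%E.
  by rewrite /excess_rate (cvg_lim _ wasserstein_phi).
split.
  by split; apply/cvg_ex; eexists; apply: cvg_fisher_quotient.
split.
- rewrite fisher_informationE//; congr (_ * _)%E.
  by apply: eq_integral => x _; rewrite u0E.
- rewrite fisher_informationE// sigma_ex; congr (_ * _)%E.
  by apply: eq_integral => x _; rewrite uexE.
rewrite fisher_informationE// /housekeeping_rate sigma_ex /entropy_production_rate.
rewrite -integral_enormB_sqr_orthogonal// => [|ic].
  have fin_grad : (\int[@lebesgue_rV R d]_x
      (enorm (grad phi x) ^+ 2 * P tau x)%:E)%E \is a fin_num.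
    rewrite ge0_fin_numE//.
    by apply: integral_ge0 => x _; rewrite lee_fin mulr_ge0 ?sqr_ge0.
  (* A constant distributes over this extended-real difference because the subtracted moment is
     finite. *)
  apply/esym; apply: muleBr; first by [].
  by apply: fin_num_adde_defl; rewrite fin_numN.
(* What is left is the orthogonality of grad phi and nu - grad phi, which reduces to div (P (nu -
   grad phi)) = 0. *)
apply: integral_grad_divergence_free => // x.
have dPw (v : 'rV[R]_d -> 'rV[R]_d) i : continuously_differentiable v ->
    derivable (fun y => (P tau y *: v y) ord0 i) x (delta_mx ord0 i).
  move=> C1v; rewrite (_ : (fun y => _) = P tau * (fun y => v y ord0 i)); last first.
    by apply/funext => y; rewrite mxE.
  by apply: derivableM; [exact: C1_derivable|exact: C1_coord_derivable].
under eq_fun do rewrite scalerBr.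
rewrite divergenceB; [|by move=> i; exact: dPw..].
(* Both divergences equal the time derivative of P, up to sign. *)
have := @derive_val _ _ _ _ _ _ _ (fokker_planckP _ tau_ab x).
by rewrite (@derive_val _ _ _ _ _ _ _ (potential_phi x)) => /oppr_inj ->; rewrite subrr.
Qed.
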